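(* Let $\kappa\in\mathbb{C}^\ast$ be a generic constant. Suppose that a subset $D\subseteq V$ is stable by $W(E_8)$ and $D+Q(E_8)\kappa=D$. Let $\tau(x)$ be an ORG $\tau$-function on $D$ with $\delta=\kappa$. Let $U=\pi_\kappa^{-1}(D)\subset\mathfrak{h}_\kappa$ and $\widetilde U=\bigsqcup_{w\in W(E_8)}\{w\}\times w.U\subset W(E_8)\times\mathfrak{h}_\kappa$. For each $\Lambda\in M$, define a function $\widetilde\tau_\Lambda$ on $\widetilde U$ by $$\widetilde\tau_\Lambda(w,h)=\tau\big(w^{-1}.(x+\kappa\alpha)\big)\qquad(w\in W(E_8),\ h\in w.U)$$ with $\alpha=\pi_0(\Lambda-e_9)\in Q(E_8)$ and $x=\pi_\kappa(h)\in w.D$. Then $\widetilde\tau_\Lambda$ $(\Lambda\in M)$ form a system of lattice $\tau$-functions on $\widetilde U$.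
   Context: Picard lattice. $\mathfrak h=\bigoplus_{i=0}^9\mathbb{C}e_i$ with symmetric bilinear form $(e_0|e_0)=-1$, $(e_j|e_j)=1$ $(1\le j\le9)$, $(e_i|e_j)=0$ $(i\ne j)$; $L=\bigoplus_{i=0}^9\mathbb{Z}e_i$; $c=3e_0-e_1-\cdots-e_9$, $d=-e_9-\frac12c$. $\alpha_0=e_0-e_1-e_2-e_3$, $\alpha_j=e_j-e_{j+1}$ $(1\le j\le8)$; $Q(E_8^{(1)})=\bigoplus_{j=0}^8\mathbb{Z}\alpha_j$, $Q(E_8)=\bigoplus_{j=0}^7\mathbb{Z}\alpha_j$. $W(E_8^{(1)})=\langle s_0,\ldots,s_8\rangle\subset GL(\mathfrak h)$ with $s_j(h)=h-(\alpha_j|h)\alpha_j$, and $W(E_8)=\langle s_0,\ldots,s_7\rangle$. For $\alpha\in\mathfrak h$ with $(c|\alpha)=0$ the Kac translation is $T_\alpha(h)=h+(c|h)\alpha-\big(\frac12(\alpha|\alpha)(c|h)+(\alpha|h)\big)c$; one has $T_\alpha T_\beta=T_{\alpha+\beta}$, $T_{kc}=\mathrm{id}$, $wT_\alpha w^{-1}=T_{w.\alpha}$ and $W(E_8^{(1)})=T(Q(E_8))\rtimes W(E_8)$. $M=W(E_8^{(1)})e_9\subset L$, equivalently $M=\{\Lambda\in L:(\Lambda|\Lambda)=1,(c|\Lambda)=-1\}$. Decomposition. $\mathfrak h=V\oplus\mathbb{C}c\oplus\mathbb{C}d$ with $V=\bigoplus_{j=0}^7\mathbb{C}\alpha_j$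 orthogonal to $c,d$. $V$ has the orthonormal basis $v_j=e_j-\frac12(e_0-e_9)+\frac12c$ $(1\le j\le7)$ and $v_0=-(e_8-\frac12(e_0-e_9)+\frac12c)$, by which $V$ is identified with $\mathbb{C}^8$ and $Q(E_8)$ with $P=\{a\in\mathbb{Z}^8\cup(\phi+\mathbb{Z}^8):(\phi|a)\in\mathbb{Z}\}$, $\phi=\frac12(v_0+\cdots+v_7)$. $\pi:\mathfrak h\to V$ is the orthogonal projection; for $\kappa\in\mathbb{C}$, $\mathfrak h_\kappa=\{h\in\mathfrak h:(c|h)=\kappa\}$ and $\pi_\kappa=\pi|_{\mathfrak h_\kappa}$ (in particular $\pi_0=\pi|_{\mathfrak h_0}$). $W(E_8)$ acts linearly on $V$. Function $[z]$. Fix a nonzero entire function $[z]$ with $[\beta\pm\gamma][z\pm\alpha]+[\gamma\pm\alpha][z\pm\beta]+[\alpha\pm\beta][z\pm\gamma]=0$ for all $z,\alpha,\beta,\gamma$, where $[\alpha\pm\beta]=[\alpha+\beta][\alpha-\beta]$, and let $\Omega$ be its set of zeros. ``Generic'' $\kappa$ means that $\delta=\kappa$ satisfies $\mathbb{Z}\kappa\cap\Omega=\{0\}$. ORG $\tau$-functions. A $C_3$-frame is a set $\{\pm a,\pm b,\pm c'\}\subset V$ of six vectors forming, up to sign, an orthonormal triple $a,b,c'$ with sums and differences of distinct members in $Q(E_8)$ and $2a,2b,2c'\in Q(E_8)$. A function $\tau$ on $D$ is an ORG $\tau$-function (with $\delta=\kappa$) if for every $C_3$-frame $\{\pm a,\pm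 b,\pm c'\}$ $$[(b\pm c'|x)]\tau(x\pm a\kappa)+[(c'\pm a|x)]\tau(x\pm b\kappa)+[(a\pm b|x)]\tau(x\pm c'\kappa)=0$$ whenever the six points lie in $D$; double signs denote products. Lattice $\tau$-functions on $\widetilde U$. $W(E_8^{(1)})$ acts on $\widetilde U$ by $T_\alpha w.(w',h)=(ww',T_\alpha w.h)$ $(\alpha\in Q(E_8), w\in W(E_8))$, and on functions by $(g.\varphi)(y)=\varphi(g^{-1}.y)$. For $\beta\in Q(E_8^{(1)})$ let $\sigma_\beta$ be the function $(w,h)\mapsto[(\beta|h)]$ on $\widetilde U$. A family $(\tau_\Lambda)_{\Lambda\in M}$ of functions on $\widetilde U$ is a system of lattice $\tau$-functions if $g.\tau_\Lambda=\tau_{g.\Lambda}$ for all $g\in W(E_8^{(1)})$, $\Lambda\in M$, and $$\sigma_{e_{jk}}\sigma_{e_{jkl}}\tau_{e_i}\tau_{e_0-e_i-e_l}+\sigma_{e_{ki}}\sigma_{e_{kil}}\tau_{e_j}\tau_{e_0-e_j-e_l}+\sigma_{e_{ij}}\sigma_{e_{ijl}}\tau_{e_k}\tau_{e_0-e_k-e_l}=0$$ for all mutually distinct $i,j,k,l\in\{1,\ldots,9\}$, where $e_{ij}=e_i-e_j$ and $e_{ijk}=e_0-e_i-e_j-e_k$. *)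

(* Defs.v *)
From HB Require Import structures.
From mathcomp Require Import all_boot all_order all_algebra.
From mathcomp Require Import complex.
From mathcomp Require Import ring.
From mathcomp Require Import all_classical all_reals all_analysis.

Set Implicit Arguments.
Unset Strict Implicit.
Unset Printing Implicit Defensive.

Import Order.TTheory GRing.Theory Num.Theory.
Import numFieldNormedType.Exports.

Local Open Scope classical_set_scope.
Local Open Scope ring_scope.

Notation hh R := 'cV[R[i]]_10.

Definition e (R : realType) (i : nat) : hh R := delta_mx (inord i) 0.
Arguments e {R} i.

(* C-bilinear (not sesquilinear), of signature (1, 9) on the real span of
   the [e i] *)
Definition form (R : realType) (x y : hh R) : R[i] :=
  - (x ord0 0 * y ord0 0) + \sum_(j < 10 | j != ord0) x j 0 * y j 0.

Definition cvec (R : realType) : hh R := 3%:R *: e 0 - \sum_(1 <= j < 10) e j.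
Definition dvec (R : realType) : hh R := - e 9 - 2%:R^-1 *: cvec R.
Arguments cvec {R}.
Arguments dvec {R}.

(* meaningful for [j <= 8] *)
Definition alpha (R : realType) (j : nat) : hh R :=
  if j == 0%N then e 0 - e 1 - e 2 - e 3 else e j - e j.+1.
Arguments alpha {R} j.

Definition QE8 (R : realType) : set (hh R) :=
  [set h | exists n : 'I_8 -> int, h = \sum_(j < 8) alpha j *~ n j].

Definition VE8 (R : realType) : set (hh R) :=
  [set h | exists t : 'I_8 -> R[i], h = \sum_(j < 8) t j *: alpha j].
Arguments QE8 {R}.
Arguments VE8 {R}.

(* The orthogonal projection onto [VE8] along the span of [cvec] and [dvec]:
   (c|c) = (d|d) = 0 and (c|d) = 1, so the c- and d-coordinates of h are (d|h)
   and (c|h). *)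
Definition projV (R : realType) (h : hh R) : hh R :=
  h - form dvec h *: cvec - form cvec h *: dvec.

(* Elements of GL(h) are matrices acting on columns by left multiplication. *)
Definition mx_of (R : realType) (f : hh R -> hh R) : 'M[R[i]]_10 :=
  \matrix_(i, j) f (delta_mx j 0) i 0.

Definition refl (R : realType) (j : nat) : 'M[R[i]]_10 :=
  mx_of (fun h : hh R => h - form (alpha j) h *: alpha j).

Definition transl (R : realType) (a : hh R) : 'M[R[i]]_10 :=
  mx_of (fun h => h + form cvec h *: a
                  - (2%:R^-1 * form a a * form cvec h + form a h) *: cvec).

Inductive generated (R : realType) (S : set 'M[R[i]]_10) :
    'M[R[i]]_10 -> Prop :=
| generated1 : generated S 1%:M
| generated_gen A : S A -> generated S A
| generatedM A B : generated S A -> generated S B -> generated S (A *m B)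
| generatedV A : generated S A -> generated S (invmx A).

Definition WE8 (R : realType) : set 'M[R[i]]_10 :=
  generated [set refl R j | j in [set j : nat | (j < 8)%N]].

Definition WE81 (R : realType) : set 'M[R[i]]_10 :=
  generated [set refl R j | j in [set j : nat | (j < 9)%N]].
Arguments WE8 {R}.
Arguments WE81 {R}.

Definition Mlat (R : realType) : set (hh R) := [set g *m e 9 | g in WE81].
Arguments Mlat {R}.

(* The component [w] in W(E8) of [g = T_a w], for [g] in
   W(E8^(1)) = T(Q(E8)) ><| W(E8). *)
Definition finite_part (R : realType) (g : 'M[R[i]]_10) : 'M[R[i]]_10 :=
  xget 1%:M [set w | WE8 w /\ exists2 a, QE8 a & g = transl a *m w].

Definition entire (R : realType) (f : R[i] -> R[i]) : Prop :=
  forall z : R[i], derivable (f : R[i]^o -> R[i]^o) z 1.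

Definition pm (R : realType) (f : R[i] -> R[i]) (x y : R[i]) : R[i] :=
  f (x + y) * f (x - y).

Definition three_term (R : realType) (f : R[i] -> R[i]) : Prop :=
  forall z a b c : R[i],
    pm f b c * pm f z a + pm f c a * pm f z b + pm f a b * pm f z c = 0.

Definition zeros (R : realType) (f : R[i] -> R[i]) : set R[i] :=
  [set z | f z = 0].

Definition generic (R : realType) (f : R[i] -> R[i]) (kappa : R[i]) : Prop :=
  [set n%:~R * kappa | n in [set: int]] `&` zeros f = [set 0].

(* The six-element set {a, -a, b, -b, c, -c} is presented by (a, b, c);
   all the presentations of a frame are quantified over in [ORG_tau]. *)
Definition C3_frame (R : realType) (a b c : hh R) : Prop :=
  [/\ [/\ VE8 a, VE8 b & VE8 c],
      [/\ form a a = 1, form b b = 1 & form c c = 1],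
      [/\ form a b = 0, form a c = 0 & form b c = 0],
      [/\ QE8 (a + b), QE8 (a - b), QE8 (a + c) &
          [/\ QE8 (a - c), QE8 (b + c) & QE8 (b - c)]] &
      [/\ QE8 (a *+ 2), QE8 (b *+ 2) & QE8 (c *+ 2)]].

(* A function on [D] is represented by a total function of which only the
   values on [D] matter. *)
Definition ORG_tau (R : realType) (f : R[i] -> R[i]) (kappa : R[i])
    (D : set (hh R)) (tau : hh R -> R[i]) : Prop :=
  forall (a b c x : hh R), C3_frame a b c -> VE8 x ->
    D (x + kappa *: a) -> D (x - kappa *: a) ->
    D (x + kappa *: b) -> D (x - kappa *: b) ->
    D (x + kappa *: c) -> D (x - kappa *: c) ->
    f (form (b + c) x) * f (form (b - c) x)
      * (tau (x + kappa *: a) * tau (x - kappa *: a))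
    + f (form (c + a) x) * f (form (c - a) x)
      * (tau (x + kappa *: b) * tau (x - kappa *: b))
    + f (form (a + b) x) * f (form (a - b) x)
      * (tau (x + kappa *: c) * tau (x - kappa *: c)) = 0.

Definition Uset (R : realType) (kappa : R[i]) (D : set (hh R)) : set (hh R) :=
  [set h | form cvec h = kappa /\ D (projV h)].

Definition Utilde (R : realType) (kappa : R[i]) (D : set (hh R)) :
    set ('M[R[i]]_10 * hh R) :=
  [set y | WE8 y.1 /\ [set y.1 *m h | h in Uset kappa D] y.2].

Definition act (R : realType) (g : 'M[R[i]]_10) (y : 'M[R[i]]_10 * hh R) :
    'M[R[i]]_10 * hh R :=
  (finite_part g *m y.1, g *m y.2).

Definition sigma (R : realType) (f : R[i] -> R[i]) (b : hh R)
    (y : 'M[R[i]]_10 * hh R) : R[i] :=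
  f (form b y.2).

Definition e2 (R : realType) (i j : nat) : hh R := e i - e j.
Definition e3 (R : realType) (i j k : nat) : hh R := e 0 - e i - e j - e k.
Arguments e2 {R} i j.
Arguments e3 {R} i j k.

(* Functions on [X] are represented by total functions; the first clause says
   that [act] restricts to [X], so that [g.phi] is again a function on [X]. *)
Definition lattice_tau (R : realType) (f : R[i] -> R[i])
    (X : set ('M[R[i]]_10 * hh R))
    (tau : hh R -> 'M[R[i]]_10 * hh R -> R[i]) : Prop :=
  [/\ forall g y, WE81 g -> X y -> X (act g y),
      forall g L y, WE81 g -> Mlat L -> X y ->
        tau L (act (invmx g) y) = tau (g *m L) y &
      forall i j k l : nat,
        all (fun m => (1 <= m <= 9)%N) [:: i; j; k; l] ->
        uniq [:: i; j; k; l] ->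
        forall y, X y ->
          sigma f (e2 j k) y * sigma f (e3 j k l) y
            * tau (e i) y * tau (e 0 - e i - e l) y
          + sigma f (e2 k i) y * sigma f (e3 k i l) y
            * tau (e j) y * tau (e 0 - e j - e l) y
          + sigma f (e2 i j) y * sigma f (e3 i j l) y
            * tau (e k) y * tau (e 0 - e k - e l) y = 0].

Definition tau_arg (R : realType) (kappa : R[i]) (L : hh R)
    (y : 'M[R[i]]_10 * hh R) : hh R :=
  invmx y.1 *m (projV y.2 + kappa *: projV (L - e 9)).

Definition tau_tilde (R : realType) (kappa : R[i]) (tau : hh R -> R[i])
    (L : hh R) (y : 'M[R[i]]_10 * hh R) : R[i] :=
  tau (tau_arg kappa L y).

Lemma formDr (R : realType) (x y z : hh R) (t : R[i]) :
  form x (t *: y + z) = t * form x y + form x z.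
Proof.
rewrite /form !mxE mulrDr mulrCA !mulrDr mulrN opprD.
under eq_bigr do rewrite !mxE mulrDr mulrCA.
by rewrite big_split /= -mulr_sumr addrACA.
Qed.

Lemma mx_ofE (R : realType) (f : hh R -> hh R) :
  (forall t x y, f (t *: x + y) = t *: f x + f y) ->
  forall h, mx_of f *m h = f h.
Proof.
move=> flin h.
have f0 : f 0 = 0.
  by have := flin (-1) 0 0; rewrite scaler0 addr0 scaleN1r addNr.
have fsum (r : seq 'I_10) (F : 'I_10 -> hh R) (t : 'I_10 -> R[i]) :
    f (\sum_(j <- r) t j *: F j) = \sum_(j <- r) t j *: f (F j).
  elim: r => [|j r IH]; first by rewrite !big_nil.
  by rewrite !big_cons flin IH.
have -> : f h = f (\sum_j h j 0 *: delta_mx j 0).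
  congr f; apply/matrixP => i k; rewrite ord1 summxE (bigD1 i) //= big1.
    by rewrite !mxE !eqxx mulr1 addr0.
  by move=> j ne; rewrite !mxE eq_sym (negbTE ne) mulr0.
rewrite fsum; apply/matrixP => i k; rewrite ord1 summxE mxE.
by apply: eq_bigr => j _; rewrite !mxE mulrC.
Qed.

Lemma reflE (R : realType) (j : nat) (h : hh R) :
  refl R j *m h = h - form (alpha j) h *: alpha j.
Proof.
apply: (@mx_ofE R (fun h => h - form (alpha j) h *: alpha j)) => t x y.
by rewrite formDr scalerDl -scalerA scalerBr opprD addrACA.
Qed.

Lemma translE (R : realType) (a h : hh R) :
  transl a *m h = h + form cvec h *: a
    - (2%:R^-1 * form a a * form cvec h + form a h) *: cvec.
Proof.
apply: (@mx_ofE R (fun h => h + form cvec h *: a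
  - (2%:R^-1 * form a a * form cvec h + form a h) *: cvec)) => t x y.
rewrite !formDr.
move: (2%:R^-1 * form a a) (form cvec x) (form cvec y) (form a x) (form a y).
move: cvec => v q p1 p2 p3 p4.
by apply/matrixP => i k; rewrite !mxE; ring.
Qed.

(* Main.v *)
Require Import Defs.
From HB Require Import structures.
From mathcomp Require Import all_boot all_order all_algebra.
From mathcomp Require Import complex.
From mathcomp Require Import ring.
From mathcomp Require Import all_classical all_reals all_analysis.

Set Implicit Arguments.
Unset Strict Implicit.
Unset Printing Implicit Defensive.

Import Order.TTheory GRing.Theory Num.Theory.
Import numFieldNormedType.Exports.

Local Open Scope classical_set_scope.
Local Open Scope ring_scope.

(* [form] also names a notion of the sesquilinear form library: this import
   makes it mean the form of the Picard lattice again. *)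
Import Defs.

(** Everything follows from two facts: an element of [W(E8^(1))] is a
    translation [T_a], with [a] in [Q(E8)], times an element [w] of [W(E8)];
    and the ORG relation of a frame, read at a suitable point, is the lattice
    relation.

    For the first, elements of [W(E8)] are isometries that fix [c] and [d] and
    preserve [Q(E8)] (shown by induction on words in the simple reflections), so
    that they commute with [projV] and satisfy [w T_a = T_(w a) w].  The highest root
    [theta = c - alpha_8] is built from simple roots by adding roots of scalar
    product -1, so its reflection lies in [W(E8)] ([E8_root_theta]), and
    [s_8 = T_theta s_theta] ([reflection_alpha8]).  Hence
    [WE81_decomposition].  Since [T_a] moves [projV h] by [(c|h) a], the shift
    is [kappa a] for [h] of level [kappa], and it is [- a] for a vector [L] of
    the orbit of [e_9], where [(c|L) = -1].  In
    [projV h + kappa projV L] the two shifts cancel, which gives the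
    equivariance ([transl_cancel]); and [projV (L - e_9)] is in [Q(E8)].

    For the second, fix [l] and put [m = (e_0 - e_l) / 2].  Then [e_i] and
    [e_0 - e_i - e_l] are [m + b_i] and [m - b_i], with [b_i = e_i - m].  The
    vectors [b_i], [i <> l], are orthonormal and orthogonal to [c], so three
    of their projections [a_i] form a [C_3]-frame ([C3_frame_vec]), with
    [a_i - a_j = projV (e_i - e_j)] and
    [a_i + a_j = - projV (e_0 - e_i - e_j - e_l)].  The ORG relation is taken
    at the point [projV h + kappa projV m]; since [(c|m) = -1], the
    [kappa]-terms cancel in the scalar products of that point with sums and
    differences of frame vectors, which are therefore those of the lattice
    relation up to sign ([form_projV_centre]).  The sign is harmless because
    the three-term relation forces [f (- z) = eps * f z] for a constant [eps]
    ([three_term_parity]). *)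

(** * The bilinear form and the projection *)

Lemma formC (R : realType) (x y : hh R) : form x y = form y x.
Proof. by rewrite /form mulrC; under eq_bigr do rewrite mulrC. Qed.

Lemma form0r (R : realType) (x : hh R) : form x 0 = 0.
Proof.
have := formDr x 0 0 1; rewrite scale1r addr0 mul1r => /eqP.
by rewrite -subr_eq0 opprD addNKr oppr_eq0 => /eqP.
Qed.

Lemma formZr (R : realType) (x y : hh R) (t : R[i]) :
  form x (t *: y) = t * form x y.
Proof. by rewrite -[t *: y]addr0 formDr form0r addr0. Qed.

Lemma form_addr (R : realType) (x y z : hh R) :
  form x (y + z) = form x y + form x z.
Proof. by rewrite -[y]scale1r formDr mul1r scale1r. Qed.

Lemma formNr (R : realType) (x y : hh R) : form x (- y) = - form x y.
Proof. by rewrite -scaleN1r formZr mulN1r. Qed.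

Lemma formZl (R : realType) (x y : hh R) (t : R[i]) :
  form (t *: x) y = t * form x y.
Proof. by rewrite formC formZr formC. Qed.

Lemma form_addl (R : realType) (x y z : hh R) :
  form (y + z) x = form y x + form z x.
Proof. by rewrite ![form _ x]formC form_addr. Qed.

Lemma formNl (R : realType) (x y : hh R) : form (- x) y = - form x y.
Proof. by rewrite formC formNr formC. Qed.

Lemma form0l (R : realType) (x : hh R) : form 0 x = 0.
Proof. by rewrite formC form0r. Qed.

Definition formE := (form_addl, form_addr, formNl, formNr, formZl, formZr,
  form0l, form0r).

Lemma form_ee (R : realType) (i j : nat) : (i < 10)%N -> (j < 10)%N ->
  form (e i) (e j) = (if i == 0%N then -1 else 1) * (i == j)%:R :> R[i].
Proof.
move=> i10 j10; rewrite /form /e !mxE !eqxx !andbT.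
have inordE m n : (m < 10)%N -> (n < 10)%N ->
    ((inord m : 'I_10) == inord n) = (m == n).
  by move=> m10 n10; rewrite -val_eqE /= !inordK.
rewrite -[ord0](inord_val ord0) !inordE //=.
have [-> | i0] := eqVneq i 0%N.
  rewrite mul1r mulN1r big1 ?addr0 // => k k0.
  by rewrite !mxE eqxx andbT (negPf k0) mul0r.
rewrite mulr0n mul0r oppr0 add0r mul1r.
rewrite (bigD1 (inord i)) /=; last first.
  by rewrite inordE.
rewrite !mxE !eqxx mul1r andbT inordE // big1 ?addr0 // => k /andP[_ ki].
by rewrite !mxE (negPf ki) mul0r.
Qed.

(** [c] and [d] unfold to sums, so that rewriting with the bilinearity rules
    would expand them: the next two lemmas do so on demand. *)
Lemma form_cr (R : realType) (x : hh R) : form x cvec = 3%:R * form x (e 0)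
  - (form x (e 1) + (form x (e 2) + (form x (e 3) + (form x (e 4)
  + (form x (e 5) + (form x (e 6) + (form x (e 7) + (form x (e 8)
  + form x (e 9))))))))).
Proof.
rewrite /cvec; do 9 (rewrite big_ltn; last exact: isT).
by rewrite big_geq ?addr0 // !formE.
Qed.

Lemma form_dr (R : realType) (x : hh R) :
  form x dvec = - form x (e 9) - 2%:R^-1 * form x cvec.
Proof. by rewrite /dvec form_addr !formNr formZr. Qed.

Lemma form_ce (R : realType) (j : nat) : (j < 10)%N ->
  form cvec (e j) = (if j == 0%N then - 3%:R else - 1) :> R[i].
Proof.
rewrite formC form_cr => j10; rewrite !form_ee //.
by move: j10; do 10 (case: j => [_|j]; first by rewrite /=; ring).
Qed.

Lemma form_cc (R : realType) : form cvec cvec = 0 :> R[i].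
Proof. by rewrite form_cr !form_ce //=; ring. Qed.

Lemma form_cd (R : realType) : form cvec dvec = 1 :> R[i].
Proof. by rewrite form_dr form_cc form_ce //=; ring. Qed.

Lemma form_de (R : realType) (j : nat) : (j < 10)%N ->
  form dvec (e j) = 2%:R^-1 * (if j == 0%N then 3%:R else 1) - (j == 9)%:R
  :> R[i].
Proof.
move=> j10; rewrite formC form_dr form_ee // [form (e j) _]formC form_ce //.
by case: eqP => [->|_]; rewrite /= ?mulr0n; ring.
Qed.

Lemma form_dd (R : realType) : form dvec dvec = 0 :> R[i].
Proof.
by rewrite form_dr [form dvec cvec]formC form_cd form_de //=; field.
Qed.

Lemma projV_linear (R : realType) (t : R[i]) (x y : hh R) :
  projV (t *: x + y) = t *: projV x + projV y.
Proof.
rewrite /projV !formDr; move: cvec dvec => c d.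
by apply/matrixP => i j; rewrite !mxE; ring.
Qed.

Lemma projV0 (R : realType) : projV 0 = 0 :> hh R.
Proof.
by have := @projV_linear R (-1) 0 0; rewrite scaler0 addr0 scaleN1r addNr.
Qed.

Lemma projVZ (R : realType) (t : R[i]) (x : hh R) :
  projV (t *: x) = t *: projV x.
Proof. by rewrite -[t *: x]addr0 projV_linear projV0 addr0. Qed.

Lemma projVD (R : realType) (x y : hh R) : projV (x + y) = projV x + projV y.
Proof. by rewrite -[x in LHS]scale1r projV_linear scale1r. Qed.

Lemma projVN (R : realType) (x : hh R) : projV (- x) = - projV x.
Proof. by rewrite -scaleN1r projVZ scaleN1r. Qed.

Lemma projV_c (R : realType) : projV cvec = 0 :> hh R.
Proof.
by rewrite /projV formC form_cd form_cc scale1r scale0r subr0 subrr.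
Qed.

Lemma projV_d (R : realType) : projV dvec = 0 :> hh R.
Proof.
by rewrite /projV form_dd form_cd scale1r scale0r subr0 subrr.
Qed.

Lemma e9E (R : realType) : e 9 = - dvec - 2%:R^-1 *: cvec :> hh R.
Proof. by rewrite /dvec opprB opprK addrC addKr. Qed.

Lemma projV_e9 (R : realType) : projV (e 9) = 0 :> hh R.
Proof.
by rewrite e9E projVD !projVN projVZ projV_d projV_c scaler0 !oppr0 addr0.
Qed.

Lemma projV_sub_e9 (R : realType) (x : hh R) : projV (x - e 9) = projV x.
Proof. by rewrite projVD projVN projV_e9 subr0. Qed.

Lemma projV_id (R : realType) (x : hh R) :
  form cvec x = 0 -> form dvec x = 0 -> projV x = x.
Proof. by rewrite /projV => -> ->; rewrite !scale0r !subr0. Qed.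

(** [c] and [d] span a hyperbolic plane orthogonal to [V]. *)
Lemma form_projV (R : realType) (x y : hh R) :
  form (projV x) (projV y)
  = form x y - form dvec x * form cvec y - form cvec x * form dvec y.
Proof.
rewrite /projV.
move: cvec dvec (form_cc R) (form_cd R) (form_dd R) => c d cc cd dd.
rewrite !formE [form d c]formC cc cd dd [form x c]formC [form x d]formC.
by ring.
Qed.

(** * The root lattice and its complex span *)

Lemma QE8_0 (R : realType) : QE8 (0 : hh R).
Proof. by exists (fun=> 0); rewrite big1. Qed.

Lemma QE8_D (R : realType) (x y : hh R) : QE8 x -> QE8 y -> QE8 (x + y).
Proof.
move=> [m ->] [n ->]; exists (fun j => m j + n j).
by rewrite -big_split; apply: eq_bigr => j _; rewrite mulrzDr.
Qed.

Lemma QE8_N (R : realType) (x : hh R) : QE8 x -> QE8 (- x).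
Proof.
move=> [m ->]; exists (fun j => - m j).
by rewrite -sumrN; apply: eq_bigr => j _; rewrite mulrNz.
Qed.

Lemma QE8_B (R : realType) (x y : hh R) : QE8 x -> QE8 y -> QE8 (x - y).
Proof. by move=> Qx Qy; apply: QE8_D => //; apply: QE8_N. Qed.

Lemma QE8_alpha (R : realType) (j : nat) : (j < 8)%N -> QE8 (alpha j : hh R).
Proof.
move=> j8; exists (fun i => (val i == j)%:Z).
rewrite (bigD1 (Ordinal j8)) //= eqxx mulr1z big1 ?addr0 // => i.
by rewrite -val_eqE /= => /negPf ->; rewrite mulr0z.
Qed.

Lemma QE8_ind (R : realType) (P : hh R -> Prop) :
  P 0 -> (forall x y, P x -> P y -> P (x + y)) -> (forall x, P x -> P (- x)) ->
  (forall j, (j < 8)%N -> P (alpha j)) -> forall x, QE8 x -> P x.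
Proof.
move=> P0 PD PN Pa x [n ->]; elim/big_ind: _ => // j _.
have Pn m : P (alpha j *+ m).
  by elim: m => [|m IH]; rewrite ?mulr0n // mulrS; apply: PD => //; apply: Pa.
by case: (n j) => m; [exact: Pn | apply: PN; exact: Pn].
Qed.

Lemma QE8_VE8 (R : realType) (x : hh R) : QE8 x -> VE8 x.
Proof.
move=> [n ->]; exists (fun j => (n j)%:~R).
by apply: eq_bigr => j _; rewrite scaler_int.
Qed.

Lemma VE8_D (R : realType) (x y : hh R) : VE8 x -> VE8 y -> VE8 (x + y).
Proof.
move=> [m ->] [n ->]; exists (fun j => m j + n j).
by rewrite -big_split; apply: eq_bigr => j _; rewrite scalerDl.
Qed.

Lemma VE8_Z (R : realType) (t : R[i]) (x : hh R) : VE8 x -> VE8 (t *: x).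
Proof.
move=> [m ->]; exists (fun j => t * m j).
by rewrite scaler_sumr; apply: eq_bigr => j _; rewrite scalerA.
Qed.

Lemma VE8_ind (R : realType) (P : hh R -> Prop) :
  P 0 -> (forall x y, P x -> P y -> P (x + y)) ->
  (forall t x, P x -> P (t *: x)) ->
  (forall j, (j < 8)%N -> P (alpha j)) -> forall x, VE8 x -> P x.
Proof.
move=> P0 PD PZ Pa x [t ->]; elim/big_ind: _ => // j _.
by apply/PZ/Pa.
Qed.

Lemma form_alpha_c (R : realType) (j : nat) : (j < 9)%N ->
  form cvec (alpha j) = 0 :> R[i].
Proof.
rewrite /alpha; case: j => [|j] j8 /=.
  by rewrite !(form_addr, formNr) !form_ce //=; ring.
by rewrite form_addr formNr !form_ce ?subrr //= ltnW.
Qed.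

Lemma form_alpha_d (R : realType) (j : nat) : (j < 8)%N ->
  form dvec (alpha j) = 0 :> R[i].
Proof.
rewrite /alpha; case: j => [|j] j8 /=.
  by rewrite !(form_addr, formNr) !form_de //=; field.
have j9 : (j.+1 < 9)%N by exact: ltnW.
rewrite form_addr formNr !form_de //=; last exact: ltnW.
by rewrite (ltn_eqF j9) (ltn_eqF (j8 : (j.+2 < 9)%N)) subrr.
Qed.

Lemma VE8_form_c (R : realType) (x : hh R) : VE8 x -> form cvec x = 0.
Proof.
move=> Vx; elim/VE8_ind: x / Vx => [|y z cy cz|t y cy|j j8].
- exact: form0r.
- by rewrite form_addr cy cz addr0.
- by rewrite formZr cy mulr0.
- by rewrite form_alpha_c // ltnW.
Qed.

Lemma VE8_form_d (R : realType) (x : hh R) : VE8 x -> form dvec x = 0.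
Proof.
move=> Vx; elim/VE8_ind: x / Vx => [|y z cy cz|t y cy|j j8].
- exact: form0r.
- by rewrite form_addr cy cz addr0.
- by rewrite formZr cy mulr0.
- by rewrite form_alpha_d.
Qed.

Lemma projV_VE8_id (R : realType) (x : hh R) : VE8 x -> projV x = x.
Proof. by move=> Vx; rewrite projV_id // ?VE8_form_c // VE8_form_d. Qed.

Lemma form_alpha_alpha (R : realType) (j : nat) : (j < 9)%N ->
  form (alpha j) (alpha j) = 2%:R :> R[i].
Proof.
rewrite /alpha; case: j => [|j] j8 /=; rewrite !formE !form_ee //=.
- by ring.
- rewrite !eqxx !eqSS (ltn_eqF (ltnSn j)) (gtn_eqF (ltnSn j)) !mulr0n /=.
  by ring.
all: exact: ltnW.
Qed.

(** * Reflections and Weyl groups *)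

(** The reflection in the hyperplane orthogonal to [b], meant for vectors with
    [(b|b) = 2]; [refl R j] is convertible to [reflection (alpha j)]. *)
Definition reflection (R : realType) (b : hh R) : 'M[R[i]]_10 :=
  mx_of (fun h : hh R => h - form b h *: b).

Lemma reflectionE (R : realType) (b h : hh R) :
  reflection b *m h = h - form b h *: b.
Proof.
apply: (@mx_ofE R (fun h => h - form b h *: b)) => t x y.
by rewrite formDr scalerDl -scalerA scalerBr opprD addrACA.
Qed.

Lemma col_mulmx_inj (R : realType) (A B : 'M[R[i]]_10) :
  (forall h : hh R, A *m h = B *m h) -> A = B.
Proof.
move=> AB; apply/matrixP => i j.
by have /matrixP/(_ i 0) := AB (delta_mx j 0); rewrite -!colE !mxE.
Qed.

Lemma reflection_invol (R : realType) (b : hh R) : form b b = 2%:R ->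
  reflection b *m reflection b = 1%:M.
Proof.
move=> bb; apply: col_mulmx_inj => h.
rewrite -mulmxA mul1mx !reflectionE !formE bb.
by apply/matrixP => i j; rewrite !mxE; ring.
Qed.

Lemma reflection_isometry (R : realType) (b x y : hh R) : form b b = 2%:R ->
  form (reflection b *m x) (reflection b *m y) = form x y.
Proof. by move=> bb; rewrite !reflectionE !formE bb [form x b]formC; ring. Qed.

Lemma reflection_conj (R : realType) (a b : hh R) : form a a = 2%:R ->
  reflection (reflection a *m b) = reflection a *m reflection b *m reflection a.
Proof.
move=> aa; apply: col_mulmx_inj => h.
have h2 : h = reflection a *m (reflection a *m h).
  by rewrite mulmxA reflection_invol // mul1mx.
rewrite reflectionE {1 2}h2 reflection_isometry // -!mulmxA.
by rewrite [reflection b *m _]reflectionE mulmxBr -scalemxAr.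
Qed.

(** In a group generated by involutions every element is a product of
    generators, so that inverses need no case of their own. *)
Lemma generated_invol_ind (R : realType) (S : set 'M[R[i]]_10)
    (P : 'M[R[i]]_10 -> Prop) :
  (forall A, S A -> A *m A = 1%:M) -> P 1%:M ->
  (forall A B, S A -> P B -> P (A *m B)) ->
  forall A, generated S A -> P A.
Proof.
move=> S2 P1 PM A gA; rewrite -[A]mulmx1.
have SU B : S B -> B \in unitmx by move=> /S2 /mulmx1_unit[].
suff [_] : A \in unitmx /\
    forall B, P B -> P (A *m B) /\ P (invmx A *m B) by move=> /(_ _ P1)[].
elim: A / gA => [|A SA|A B _ [uA IA] _ [uB IB]|A _ [uA IA]].
- by rewrite unitmx1; split=> // B PB; rewrite invmx1 mul1mx.
- split=> [|B PB]; first exact: SU.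
  have -> : invmx A = A.
    by rewrite -[LHS]mulmx1 -(S2 _ SA) mulmxA mulVmx ?mul1mx ?SU.
  by split; apply: PM.
- split=> [|C PC]; first by rewrite unitmx_mul uA.
  have -> : invmx (A *m B) = invmx B *m invmx A.
    exact: (@invrM 'M[R[i]]_10 A B uA uB).
  rewrite -!mulmxA; split; first by apply IA; apply IB.
  by apply IB; apply IA.
- by rewrite unitmx_inv invmxK; split=> // B /IA[].
Qed.

Lemma WE8_ind (R : realType) (P : 'M[R[i]]_10 -> Prop) : P 1%:M ->
  (forall j B, (j < 8)%N -> P B -> P (reflection (alpha j) *m B)) ->
  forall A, WE8 A -> P A.
Proof.
move=> P1 PM; apply: generated_invol_ind => // A.
- by move=> [j /= j8 <-]; rewrite reflection_invol // form_alpha_alpha // ltnW.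
- by move=> B [j /= j8 <-]; apply: PM.
Qed.

Lemma WE81_ind (R : realType) (P : 'M[R[i]]_10 -> Prop) : P 1%:M ->
  (forall j B, (j < 9)%N -> P B -> P (reflection (alpha j) *m B)) ->
  forall A, WE81 A -> P A.
Proof.
move=> P1 PM; apply: generated_invol_ind => // A.
- by move=> [j /= j9 <-]; rewrite reflection_invol // form_alpha_alpha.
- by move=> B [j /= j9 <-]; apply: PM.
Qed.

Lemma WE8_reflection (R : realType) (j : nat) : (j < 8)%N ->
  WE8 (reflection (alpha j : hh R)).
Proof. by move=> j8; apply: generated_gen; exists j. Qed.

Lemma WE8_unit (R : realType) (w : 'M[R[i]]_10) : WE8 w -> w \in unitmx.
Proof.
move=> Ww; elim/WE8_ind: w / Ww => [|j B j8 uB]; first exact: unitmx1.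
rewrite unitmx_mul uB andbT.
have j9 : (j < 9)%N by exact: ltnW.
by have /mulmx1_unit[] := reflection_invol (@form_alpha_alpha R _ j9).
Qed.

Lemma WE8_invmx (R : realType) (w : 'M[R[i]]_10) : WE8 w -> WE8 (invmx w).
Proof. exact: generatedV. Qed.

Lemma WE81_unit (R : realType) (g : 'M[R[i]]_10) : WE81 g -> g \in unitmx.
Proof.
move=> Wg; elim/WE81_ind: g / Wg => [|j B j9 uB]; first exact: unitmx1.
rewrite unitmx_mul uB andbT.
by have /mulmx1_unit[] := reflection_invol (@form_alpha_alpha R _ j9).
Qed.

Lemma WE8_form (R : realType) (w : 'M[R[i]]_10) (x y : hh R) : WE8 w ->
  form (w *m x) (w *m y) = form x y.
Proof.
move=> Ww; elim/WE8_ind: w / Ww => [|j B j8 IB]; first by rewrite !mul1mx.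
by rewrite -!mulmxA reflection_isometry ?form_alpha_alpha // ltnW.
Qed.

Lemma WE8_c (R : realType) (w : 'M[R[i]]_10) : WE8 w -> w *m cvec = cvec.
Proof.
move=> Ww; elim/WE8_ind: w / Ww => [|j B j8 IB]; first by rewrite mul1mx.
by rewrite -mulmxA IB reflectionE formC form_alpha_c ?scale0r ?subr0 // ltnW.
Qed.

Lemma WE8_d (R : realType) (w : 'M[R[i]]_10) : WE8 w -> w *m dvec = dvec.
Proof.
move=> Ww; elim/WE8_ind: w / Ww => [|j B j8 IB]; first by rewrite mul1mx.
by rewrite -mulmxA IB reflectionE formC form_alpha_d ?scale0r ?subr0.
Qed.

Lemma WE8_form_c (R : realType) (w : 'M[R[i]]_10) (x : hh R) : WE8 w ->
  form cvec (w *m x) = form cvec x.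
Proof. by move=> Ww; rewrite -{1}(WE8_c Ww) WE8_form. Qed.

Lemma WE8_projV (R : realType) (w : 'M[R[i]]_10) (x : hh R) : WE8 w ->
  projV (w *m x) = w *m projV x.
Proof.
move=> Ww; rewrite /projV !mulmxBr -!scalemxAr WE8_c // WE8_d // WE8_form_c //.
by rewrite -{1}(WE8_d Ww) WE8_form.
Qed.

Lemma form_alpha_int (R : realType) (i j : nat) : (i < 8)%N -> (j < 8)%N ->
  exists n : int, form (alpha i) (alpha j) = n%:~R :> R[i].
Proof.
pose isint (t : R[i]) := exists n : int, t = n%:~R.
have intD s t : isint s -> isint t -> isint (s + t).
  by move=> [m ->] [n ->]; exists (m + n); rewrite intrD.
have intN t : isint t -> isint (- t).
  by move=> [m ->]; exists (- m); rewrite intrN.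
have ee m n : (m < 9)%N -> (n < 9)%N -> isint (form (e m) (e n)).
  move=> m9 n9; rewrite form_ee; [|exact: ltnW|exact: ltnW].
  exists ((if m == 0%N then -1 else 1) * (m == n)%:Z).
  by case: ifP => _; rewrite ?mulN1r ?mul1r ?intrN.
move=> i8 j8; rewrite -/(isint _) /alpha.
have [i9 j9] : (i < 9)%N /\ (j < 9)%N by split; exact: ltnW.
have [i9' j9'] : (i.+1 < 9)%N /\ (j.+1 < 9)%N by [].
case: eqP => _; case: eqP => _; rewrite !formE;
  by do ![by apply: ee | apply/intN | apply/intD].
Qed.

Lemma WE8_QE8 (R : realType) (w : 'M[R[i]]_10) (x : hh R) : WE8 w ->
  QE8 x -> QE8 (w *m x).
Proof.
move=> Ww; elim/WE8_ind: w / Ww x => [x|j B j8 IB x Qx].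
  by rewrite mul1mx.
rewrite -mulmxA; move: {IB Qx}(B *m x) (IB _ Qx) => {}x Qx.
elim/QE8_ind: x / Qx => [|y z Qy Qz|y Qy|k k8].
- by rewrite mulmx0; apply: QE8_0.
- by rewrite mulmxDr; apply: QE8_D.
- by rewrite mulmxN; apply: QE8_N.
rewrite reflectionE; apply: QE8_B; first exact: QE8_alpha.
have [n ->] := @form_alpha_int R j k j8 k8.
rewrite scaler_int; have Qn m : QE8 (alpha j *+ m : hh R).
  elim: m => [|m IH]; first exact: QE8_0.
  by rewrite mulrS; apply: QE8_D => //; apply: QE8_alpha.
by case: n => m; [exact: Qn | apply: QE8_N; exact: Qn].
Qed.

Lemma WE8_VE8 (R : realType) (w : 'M[R[i]]_10) (x : hh R) : WE8 w ->
  VE8 x -> VE8 (w *m x).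
Proof.
move=> Ww Vx; elim/VE8_ind: x / Vx => [|y z Qy Qz|t y Qy|k k8].
- by rewrite mulmx0; apply: QE8_VE8; apply: QE8_0.
- by rewrite mulmxDr; apply: VE8_D.
- by rewrite -scalemxAr; apply: VE8_Z.
by apply/QE8_VE8/WE8_QE8 => //; apply: QE8_alpha.
Qed.

(** * The highest root and the semidirect decomposition *)

(** A vector of norm 2 of [Q(E8)] whose reflection belongs to [W(E8)]. *)
Definition E8_root (R : realType) (b : hh R) : Prop :=
  [/\ QE8 b, form b b = 2%:R & WE8 (reflection b)].

Lemma E8_root_alpha (R : realType) (j : nat) : (j < 8)%N ->
  E8_root (alpha j : hh R).
Proof.
move=> j8; split; first exact: QE8_alpha.
  by rewrite form_alpha_alpha // ltnW.
exact: WE8_reflection.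
Qed.

(** The sum is the image of one root under the reflection in the other. *)
Lemma E8_rootD (R : realType) (a b : hh R) : E8_root a -> E8_root b ->
  form a b = - 1 -> E8_root (a + b).
Proof.
move=> [Qa aa Wa] [Qb bb Wb] ab.
have sab : reflection a *m b = a + b.
  by rewrite reflectionE ab scaleN1r opprK addrC.
split; first exact: QE8_D.
  by rewrite -sab reflection_isometry.
by rewrite -sab reflection_conj //; do 2 (apply: generatedM => //).
Qed.

Lemma E8_root_e2 (R : realType) (i j : nat) : (0 < i)%N -> (i < j)%N ->
  (j < 9)%N -> E8_root (e2 i j : hh R).
Proof.
move=> i0; elim: j => // j IH; rewrite ltnS leq_eqVlt => /orP[/eqP <-|ij] j9.
  by have := @E8_root_alpha R i j9; rewrite /alpha (gtn_eqF i0).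
have -> : e2 i j.+1 = e2 i j + e2 j j.+1 :> hh R.
  by rewrite /e2 addrA subrK.
apply: E8_rootD.
- by apply: IH => //; apply: ltnW.
- have := @E8_root_alpha R j j9; rewrite /alpha gtn_eqF //.
  exact: ltn_trans ij.
have j10 : (j < 10)%N by exact: ltnW (ltnW j9).
rewrite /e2 !formE !form_ee //;
  try by [exact: ltnW | exact: ltn_trans ij j10].
rewrite (gtn_eqF i0) (gtn_eqF (ltn_trans i0 ij)) (ltn_eqF ij) eqxx.
rewrite (ltn_eqF (ltn_trans ij (ltnSn j))) (ltn_eqF (ltnSn j)) !mulr0n /=.
by ring.
Qed.

(** [c - alpha_8 = 3 e_0 - e_1 - ... - e_7 - 2 e_8] is the highest root of
    [E8]. *)
Lemma E8_root_theta (R : realType) : E8_root (cvec - alpha 8 : hh R).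
Proof.
have e2R i j : (0 < i < j)%N -> (j < 9)%N -> E8_root (e2 i j : hh R).
  by move=> /andP[]; apply: E8_root_e2.
have fe i j : (i < 10)%N -> (j < 10)%N -> form (e i) (e j) =
    (if i == 0%N then -1 else 1) * (i == j)%:R :> R[i] by exact: form_ee.
have r123 : E8_root (e 0 - e 1 - e 2 - e 3 : hh R).
  exact: (@E8_root_alpha R 0).
have swap i j : (0 < i < j)%N -> (j < 9)%N -> forall b : hh R, E8_root b ->
    form b (e2 i j) = -1 -> E8_root (b + e2 i j).
  by move=> ij j9 b rb bij; apply: E8_rootD => //; apply: e2R.
have r456 : E8_root (e3 4 5 6 : hh R).
  have := swap 1 4 isT isT _
    (swap 2 5 isT isT _ (swap 3 6 isT isT _ r123 _) _) _.
  have -> : e 0 - e 1 - e 2 - e 3 + e2 3 6 + e2 2 5 + e2 1 4 = e3 4 5 6 :> hh R.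
    rewrite /e2 /e3; apply/matrixP => i j; rewrite !mxE; ring.
  by apply; rewrite /e2 !formE !fe //=; ring.
(* [e_0 - e_1 - e_2 - e_8]; its sum with [q] is the highest root. *)
have r128 : E8_root (e3 1 2 8 : hh R).
  have := swap 3 8 isT isT _ r123 _.
  rewrite /e2 subrKA; apply.
  by rewrite !formE !fe //=; ring.
(* [q = 2 e_0 - e_3 - ... - e_8] *)
pose q : hh R := e 0 - e 1 - e 2 - e 3 + e3 4 5 6 + e2 2 8 + e2 1 7.
have rq : E8_root q.
  apply: (swap 1 7 isT isT).
    apply: (swap 2 8 isT isT); first by apply: (E8_rootD r123 r456);
      rewrite /e3 !formE !fe //=; ring.
    by rewrite /e3 /e2 !formE !fe //=; ring.
  by rewrite /e3 /e2 !formE !fe //=; ring.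
have -> : cvec - alpha 8 = q + e3 1 2 8 :> hh R.
  rewrite /cvec; do 9 (rewrite big_ltn; last exact: isT).
  rewrite big_geq // /q /e3 /e2 /alpha /=.
  by apply/matrixP => i j; rewrite !mxE; ring.
apply: (E8_rootD rq r128).
by rewrite /q /e3 /e2 !formE !fe //=; ring.
Qed.

Lemma transl_add (R : realType) (a b : hh R) : form cvec a = 0 ->
  form cvec b = 0 -> transl a *m transl b = transl (a + b).
Proof.
move=> ca cb; apply: col_mulmx_inj => h; rewrite -mulmxA !translE.
move: cvec (form_cc R) ca cb => c cc ca cb.
rewrite !formE cc cb [form a c]formC ca [form b a]formC.
by apply/matrixP => i j; rewrite !mxE; field.
Qed.

Lemma transl0 (R : realType) : transl (0 : hh R) = 1%:M.
Proof.
apply: col_mulmx_inj => h; rewrite translE mul1mx scaler0 !form0l.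
by rewrite mulr0 mul0r !addr0 scale0r subr0.
Qed.

Lemma WE8_transl (R : realType) (w : 'M[R[i]]_10) (a : hh R) : WE8 w ->
  w *m transl a = transl (w *m a) *m w.
Proof.
move=> Ww; apply: col_mulmx_inj => h; rewrite -!mulmxA !translE.
rewrite !WE8_form // WE8_form_c //.
by rewrite mulmxBr mulmxDr -!scalemxAr WE8_c.
Qed.

Lemma form_c_transl (R : realType) (a h : hh R) : form cvec a = 0 ->
  form cvec (transl a *m h) = form cvec h.
Proof.
move=> ca; rewrite translE form_addr formNr form_addr !formZr ca form_cc.
by rewrite !mulr0 subr0 addr0.
Qed.

Lemma projV_transl (R : realType) (a h : hh R) : VE8 a ->
  projV (transl a *m h) = projV h + form cvec h *: a.
Proof.
move=> Va; rewrite translE projVD projVN !projVD !projVZ projV_c scaler0 subr0.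
by rewrite (projV_VE8_id Va).
Qed.

(** With [theta = c - alpha_8] the highest root of [E8], this reads
    [s_8 = T_theta s_theta]. *)
Lemma reflection_alpha8 (R : realType) :
  reflection (alpha 8 : hh R)
  = transl (cvec - alpha 8) *m reflection (cvec - alpha 8).
Proof.
move: (alpha 8) (form_alpha_c R (isT : 8 < 9)%N)
  (form_alpha_alpha R (isT : 8 < 9)%N) => a ca aa.
apply: col_mulmx_inj => h; rewrite -mulmxA translE !reflectionE.
move: cvec (form_cc R) ca => c cc ca.
rewrite !formE cc aa [form a c]formC ca.
by apply/matrixP => i j; rewrite !mxE; field.
Qed.

Lemma WE81_decomposition (R : realType) (g : 'M[R[i]]_10) : WE81 g ->
  exists w, WE8 w /\ exists2 a, QE8 a & g = transl a *m w.
Proof.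
move=> Wg; elim/WE81_ind: g / Wg => [|j B j9 [w [Ww [a Qa ->]]]].
  exists 1%:M; split; first exact: generated1.
  by exists 0; [exact: QE8_0 | rewrite transl0 mul1mx].
have QE8_c (b : hh R) : QE8 b -> form cvec b = 0 by move=> /QE8_VE8 /VE8_form_c.
move: j9; rewrite ltnS leq_eqVlt => /orP[/eqP -> | j8].
  move: (cvec - _) (reflection_alpha8 R) (E8_root_theta R) => t -> [Qt _ Wt].
  exists (reflection t *m w); split; first exact: generatedM.
  have Qta : QE8 (reflection t *m a) by exact: WE8_QE8.
  exists (t + reflection t *m a); first exact: QE8_D.
  rewrite -(transl_add (QE8_c _ Qt) (QE8_c _ Qta)) -!mulmxA; congr (_ *m _).
  by rewrite !mulmxA WE8_transl.
exists (reflection (alpha j) *m w); split.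
  by apply: generatedM => //; apply: WE8_reflection.
exists (reflection (alpha j) *m a).
  by apply: WE8_QE8 => //; apply: WE8_reflection.
by rewrite !mulmxA WE8_transl //; apply: WE8_reflection.
Qed.

(** Any decomposition serves in what follows, so that its uniqueness is not
    needed. *)
Lemma finite_partP (R : realType) (g : 'M[R[i]]_10) : WE81 g ->
  WE8 (finite_part g) /\ exists2 a, QE8 a & g = transl a *m finite_part g.
Proof.
move=> /WE81_decomposition [w Pw].
exact: (@xgetPex _ _ [set w | WE8 w /\ exists2 a, QE8 a & g = transl a *m w]
  (ex_intro _ w Pw)).
Qed.

(** * Projections of lattice vectors *)

Lemma QE8_projV_alpha (R : realType) (j : nat) : (j < 9)%N ->
  QE8 (projV (alpha j : hh R)).
Proof.
rewrite ltnS leq_eqVlt => /orP[/eqP -> | j8].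
  have [Qt _ _] := E8_root_theta R; have := projV_VE8_id (QE8_VE8 Qt).
  rewrite projVD projVN projV_c add0r => pt.
  by rewrite -[projV _]opprK pt; apply: QE8_N.
by rewrite projV_VE8_id; [|apply: QE8_VE8]; apply: QE8_alpha.
Qed.

(** Together with [QE8_projV_e3]: the vectors [e_i - e_j] and
    [e_0 - e_i - e_j - e_k] lie in the span of [alpha_0], ..., [alpha_8],
    which [projV] maps onto [Q(E8)]. *)
Lemma QE8_projV_e2 (R : realType) (i j : nat) : (1 <= i <= 9)%N ->
  (1 <= j <= 9)%N -> QE8 (projV (e2 i j : hh R)).
Proof.
have e1 k : (1 <= k <= 9)%N -> QE8 (projV (e2 1 k : hh R)).
  elim: k => // -[_ _|k IH /= k9].
    by rewrite /e2 subrr projV0; apply: QE8_0.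
  have -> : e2 1 k.+2 = e2 1 k.+1 + alpha k.+1 :> hh R.
    by rewrite /e2 /alpha /= addrA subrK.
  rewrite projVD; apply: QE8_D; first by apply: IH => /=; apply: ltnW.
  exact: QE8_projV_alpha.
move=> i9 j9; have -> : e2 i j = e2 1 j - e2 1 i :> hh R.
  by rewrite /e2 opprB addrCA [e 1 + _]addrC addrK.
by rewrite projVD projVN; apply: QE8_B; apply: e1.
Qed.

Lemma QE8_projV_e3 (R : realType) (i j k : nat) : (1 <= i <= 9)%N ->
  (1 <= j <= 9)%N -> (1 <= k <= 9)%N -> QE8 (projV (e3 i j k : hh R)).
Proof.
move=> i9 j9 k9.
have -> : e3 i j k = alpha 0 + e2 1 i + e2 2 j + e2 3 k :> hh R.
  by rewrite /e3 /e2 /alpha /=; apply/matrixP => p q; rewrite !mxE; ring.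
have QD (x y : hh R) : QE8 (projV x) -> QE8 (projV y) -> QE8 (projV (x + y)).
  by rewrite projVD; apply: QE8_D.
apply/QD; last exact: QE8_projV_e2.
apply/QD; last exact: QE8_projV_e2.
apply/QD; last exact: QE8_projV_e2.
exact: QE8_projV_alpha.
Qed.

Lemma QE8_projV_Mlat (R : realType) (L : hh R) : Mlat L ->
  form cvec L = - 1 /\ QE8 (projV (L - e 9)).
Proof.
move=> [g Wg <-]; have [w [Ww [a Qa ->]]] := WE81_decomposition Wg.
have w9 : w *m e 9 = e 9.
  by rewrite e9E mulmxBr mulmxN -scalemxAr WE8_c // WE8_d.
rewrite -mulmxA w9 form_c_transl ?form_ce //; last exact/VE8_form_c/QE8_VE8.
split=> //; rewrite projV_sub_e9 projV_transl; last exact: QE8_VE8.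
by rewrite projV_e9 add0r form_ce // scaleN1r; apply: QE8_N.
Qed.

Lemma VE8_projV (R : realType) (x : hh R) : VE8 (projV x).
Proof.
have Vej k : (1 <= k <= 9)%N -> VE8 (projV (e k : hh R)).
  move=> k9; rewrite -[projV (e k)]subr0 -projV_e9 -projVN -projVD.
  exact/QE8_VE8/QE8_projV_e2.
have V0 : VE8 (projV (e 0 : hh R)).
  have -> : e 0 = alpha 0 + e 1 + e 2 + e 3 :> hh R.
    by rewrite /alpha /=; apply/matrixP => p q; rewrite !mxE; ring.
  have VD (y z : hh R) : VE8 (projV y) -> VE8 (projV z) -> VE8 (projV (y + z)).
    by rewrite projVD; apply: VE8_D.
  apply/VD; last exact: Vej.
  apply/VD; last exact: Vej.
  apply/VD; last exact: Vej.
  exact/QE8_VE8/QE8_projV_alpha.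
have -> : x = \sum_(k < 10) x k 0 *: e k.
  apply/matrixP => k j; rewrite ord1 summxE (bigD1 k) //= big1 => [|l lk].
    by rewrite !mxE inord_val !eqxx mulr1 addr0.
  by rewrite !mxE inord_val eq_sym (negPf lk) mulr0.
elim/big_ind: _ => [|y z Vy Vz|[k k10] _ /=].
- by rewrite projV0; apply/QE8_VE8/QE8_0.
- by rewrite projVD; apply: VE8_D.
rewrite projVZ; apply: VE8_Z; case: k k10 => [_|k k10]; first exact: V0.
exact: Vej.
Qed.

(** * Frames of the lattice relation *)

(** Changing the sign of [a] in the relation, at [c = 0] and [z = z0] with
    [f z0 != 0], gives [f (- u) * f (- v) = f u * f v]. *)
Lemma three_term_parity (R : realType) (f : R[i] -> R[i]) : three_term f ->
  exists2 eps, eps != 0 & forall z, f (- z) = eps * f z.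
Proof.
move=> f3; have [f0|/existsNP[z0 /eqP fz0]] := pselect (forall z, f z = 0).
  by exists 1 => [|z]; rewrite ?oner_neq0 // !f0 mulr0.
have sym u v : f (- u) * f (- v) = f u * f v.
  have := f3 z0 ((u + v) / 2%:R) ((u - v) / 2%:R) 0.
  have := f3 z0 (- ((u + v) / 2%:R)) ((u - v) / 2%:R) 0.
  rewrite /pm !add0r !addr0 !subr0 !opprK.
  have -> : - ((u + v) / 2%:R) + (u - v) / 2%:R = - v by field.
  have -> : - ((u + v) / 2%:R) - (u - v) / 2%:R = - u by field.
  have -> : (u + v) / 2%:R + (u - v) / 2%:R = u by field.
  have -> : (u + v) / 2%:R - (u - v) / 2%:R = v by field.
  move=> e1 e2; have fz2 : f z0 * f z0 != 0 by rewrite mulf_neq0.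
  apply: (mulIf fz2); apply: subr0_eq; rewrite -[RHS](subrr 0).
  by rewrite -[X in _ = X - _]e1 -[X in _ = _ - X]e2; ring.
have fNz0 : f (- z0) != 0.
  have : f (- z0) * f (- z0) != 0 by rewrite sym mulf_neq0.
  by rewrite mulf_eq0 orbb.
exists (f z0 / f (- z0)) => [|z].
  by rewrite mulf_neq0 ?invr_neq0.
by apply: (mulIf fNz0); rewrite sym mulrAC divfK // mulrC.
Qed.

Lemma C3_frame_WE8 (R : realType) (w : 'M[R[i]]_10) (a b c : hh R) : WE8 w ->
  C3_frame a b c -> C3_frame (w *m a) (w *m b) (w *m c).
Proof.
move=> Ww [[Va Vb Vc] [aa bb cc] [ab ac bc] [? ? ? [? ? ?]] [? ? ?]].
have Q (x : hh R) : QE8 x -> QE8 (w *m x) by exact: WE8_QE8.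
have Q2 (x : hh R) : w *m x *+ 2 = w *m (x *+ 2) by rewrite !mulr2n mulmxDr.
split.
- by split; apply: WE8_VE8.
- by rewrite !WE8_form.
- by rewrite !WE8_form.
- by rewrite -!mulmxDr -!mulmxBr; split; [| | |split]; apply: (Q).
- by rewrite !Q2; split; apply: (Q).
Qed.

(** The midpoint of [e_i] and [e_0 - e_i - e_l], which does not depend on
    [i]. *)
Definition centre (R : realType) (l : nat) : hh R := 2%:R^-1 *: (e 0 - e l).

Lemma form_c_centre (R : realType) (l : nat) : (1 <= l <= 9)%N ->
  form cvec (centre R l) = - 1.
Proof.
case: l => // l l9; rewrite /centre formZr form_addr formNr !form_ce //=.
by field.
Qed.

Lemma form_centre (R : realType) (l : nat) : (1 <= l <= 9)%N ->
  form (centre R l) (centre R l) = 0.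
Proof.
case: l => // l l9; rewrite /centre !formE !form_ee //= eqxx /=.
by rewrite mulr0n; ring.
Qed.

Lemma form_e_centre (R : realType) (i l : nat) : (1 <= i <= 9)%N ->
  (1 <= l <= 9)%N -> i != l -> form (e i) (centre R l) = 0.
Proof.
case: i => // i; case: l => // l i9 l9 il.
rewrite /centre !formE !form_ee //= (negPf il) mulr0n; ring.
Qed.

Lemma form_e3_centre (R : realType) (i j l : nat) : (1 <= i <= 9)%N ->
  (1 <= j <= 9)%N -> (1 <= l <= 9)%N -> i != l -> j != l ->
  form (e3 i j l) (centre R l) = 0.
Proof.
move=> i9 j9 l9 il jl; rewrite /e3 !(form_addl, formNl).
rewrite (form_e_centre R i9 l9 il) (form_e_centre R j9 l9 jl).
rewrite /centre !(formZr, form_addr, formNr).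
by case: l l9 {il jl} => // l l9; rewrite !form_ee //= eqxx /=; ring.
Qed.

Lemma form_c_e3 (R : realType) (i j k : nat) : (1 <= i <= 9)%N ->
  (1 <= j <= 9)%N -> (1 <= k <= 9)%N -> form cvec (e3 i j k : hh R) = 0.
Proof.
case: i j k => [|i] [|j] [|k] // i9 j9 k9.
by rewrite /e3 !(form_addr, formNr) !form_ce //=; ring.
Qed.

Lemma form_c_e2 (R : realType) (i j : nat) : (1 <= i <= 9)%N ->
  (1 <= j <= 9)%N -> form cvec (e2 i j : hh R) = 0.
Proof.
case: i j => [|i] [|j] // i9 j9.
by rewrite /e2 form_addr formNr !form_ce //= subrr.
Qed.

Lemma form_c_frame (R : realType) (i l : nat) : (1 <= i <= 9)%N ->
  (1 <= l <= 9)%N -> form cvec (e i - centre R l) = 0.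
Proof.
move=> i9 l9; rewrite form_addr formNr form_c_centre //.
by case: i i9 => // i i9; rewrite form_ce //= subrr.
Qed.

(** The vectors of the [C_3]-frames attached to the index [l]; [i] is meant to
    differ from [l]. *)
Definition frame_vec (R : realType) (l i : nat) : hh R :=
  projV (e i - centre R l).

Lemma form_frame_vec (R : realType) (i j l : nat) : (1 <= i <= 9)%N ->
  (1 <= j <= 9)%N -> (1 <= l <= 9)%N -> i != l -> j != l ->
  form (frame_vec R l i) (frame_vec R l j) = (i == j)%:R.
Proof.
move=> i9 j9 l9 il jl; rewrite /frame_vec form_projV.
rewrite (form_c_frame R i9 l9) (form_c_frame R j9 l9) mulr0 mul0r !subr0.
move: (centre R l) (form_centre R l9) (form_e_centre R i9 l9 il)
  (form_e_centre R j9 l9 jl) => m mm im jm.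
rewrite !formE mm im [form m _]formC jm !oppr0 !(addr0, subr0).
case: i j i9 j9 {il jl im jm} => [|i] [|j] //= i9 j9.
by rewrite form_ee //= mul1r.
Qed.

Lemma frame_vecB (R : realType) (i j l : nat) :
  frame_vec R l i - frame_vec R l j = projV (e2 i j).
Proof.
rewrite /frame_vec -projVN -projVD; congr projV; rewrite /e2.
by apply/matrixP => p q; rewrite !mxE; ring.
Qed.

Lemma frame_vecD (R : realType) (i j l : nat) :
  frame_vec R l i + frame_vec R l j = - projV (e3 i j l).
Proof.
rewrite /frame_vec -projVN -projVD; congr projV; rewrite /e3 /centre.
by apply/matrixP => p q; rewrite !mxE; field.
Qed.

Lemma projV_e_centre (R : realType) (l i : nat) :
  projV (e i) = projV (centre R l) + frame_vec R l i.
Proof. by rewrite /frame_vec -projVD addrC subrK. Qed.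

Lemma projV_e0_centre (R : realType) (l i : nat) :
  projV (e 0 - e i - e l) = projV (centre R l) - frame_vec R l i.
Proof.
rewrite /frame_vec -projVN -projVD; congr projV; rewrite /centre.
by apply/matrixP => p q; rewrite !mxE; field.
Qed.

Lemma C3_frame_vec (R : realType) (i j k l : nat) :
  all (fun m => (1 <= m <= 9)%N) [:: i; j; k; l] -> uniq [:: i; j; k; l] ->
  C3_frame (frame_vec R l i) (frame_vec R l j) (frame_vec R l k).
Proof.
case/and5P=> i9 j9 k9 l9 _; rewrite /= !inE !negb_or !andbT.
case/and3P=> /and3P[ij ik il] /andP[jk jl] kl.
have QB m n : (1 <= m <= 9)%N -> (1 <= n <= 9)%N ->
    QE8 (frame_vec R l m - frame_vec R l n).
  by move=> m9 n9; rewrite frame_vecB; apply: QE8_projV_e2.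
have QD m n : (1 <= m <= 9)%N -> (1 <= n <= 9)%N ->
    QE8 (frame_vec R l m + frame_vec R l n).
  by move=> m9 n9; rewrite frame_vecD; apply: QE8_N; apply: QE8_projV_e3.
split.
- by split; apply: VE8_projV.
- by rewrite !form_frame_vec // !eqxx.
- by rewrite !form_frame_vec // (negPf ij) (negPf ik) (negPf jk).
- split; [exact: QD|exact: QB|exact: QD|split; [exact: QB|exact: QD|exact: QB]].
- by rewrite !mulr2n; split; [exact: QD|exact: QD|exact: QD].
Qed.

(** The shift by [kappa (d|u)] between [(projV u|projV h)] and [(u|h)] is
    compensated by that of the centre, as [(c|centre) = -1]. *)
Lemma form_projV_centre (R : realType) (l : nat) (kappa : R[i]) (u h : hh R) :
  (1 <= l <= 9)%N -> form cvec u = 0 -> form u (centre R l) = 0 ->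
  form cvec h = kappa ->
  form (projV u) (projV h + kappa *: projV (centre R l)) = form u h.
Proof.
move=> l9 cu um ch.
have cm := form_c_centre R l9.
rewrite addrC formDr; move: (centre R l) cm um => m cm um.
apply: (etrans (congr2 (fun s t => kappa * s + t)
  (form_projV u m) (form_projV u h))).
rewrite cu um ch cm; ring.
Qed.

(** * Lattice tau-functions *)

Lemma Utilde_elim (R : realType) (kappa : R[i]) (D : set (hh R)) y :
  Utilde kappa D y ->
  [/\ WE8 y.1, form cvec y.2 = kappa & D (invmx y.1 *m projV y.2)].
Proof.
move=> [Ww [h [ch Dh] <-]]; split=> //; first by rewrite WE8_form_c.
by rewrite WE8_projV // mulKmx // WE8_unit.
Qed.

Lemma Utilde_intro (R : realType) (kappa : R[i]) (D : set (hh R)) y :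
  WE8 y.1 -> form cvec y.2 = kappa -> D (invmx y.1 *m projV y.2) ->
  Utilde kappa D y.
Proof.
move=> Ww ch Dh; split=> //; exists (invmx y.1 *m y.2).
  have Wi := WE8_invmx Ww.
  by split; rewrite ?WE8_form_c ?WE8_projV.
by rewrite mulKVmx // WE8_unit.
Qed.

Lemma mulmx_invmxK (R : realType) (A B : 'M[R[i]]_10) (x : hh R) :
  A \in unitmx -> B \in unitmx -> invmx (A *m B) *m (A *m x) = invmx B *m x.
Proof.
move=> uA uB; rewrite -[x in LHS](mulKVmx uB) [A *m (B *m _)]mulmxA mulKmx //.
by rewrite unitmx_mul uA.
Qed.

Lemma tau_argE (R : realType) (kappa : R[i]) (L : hh R) y :
  tau_arg kappa L y = invmx y.1 *m (projV y.2 + kappa *: projV L).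
Proof. by rewrite /tau_arg projV_sub_e9. Qed.

(** The argument of [tau] does not change when [T_a p] is applied to both [h]
    and [L]: their projections move by [kappa a] and by [- a]. *)
Lemma transl_cancel (R : realType) (kappa : R[i]) (p w : 'M[R[i]]_10)
    (a h L : hh R) :
  VE8 a -> WE8 p -> WE8 w -> form cvec h = kappa -> form cvec L = - 1 ->
  invmx (p *m w) *m (projV (transl a *m (p *m h))
                     + kappa *: projV (transl a *m (p *m L)))
  = invmx w *m (projV h + kappa *: projV L).
Proof.
move=> Va Wp Ww ch cL.
rewrite (projV_transl (p *m h) Va) (projV_transl (p *m L) Va).
rewrite (WE8_form_c h Wp) (WE8_form_c L Wp) ch cL.
rewrite (WE8_projV h Wp) (WE8_projV L Wp); move: (projV h) (projV L) => u v.
rewrite -(mulmx_invmxK _ (WE8_unit Wp) (WE8_unit Ww)).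
congr (_ *m _); rewrite mulmxDr -scalemxAr.
by apply/matrixP => i j; rewrite !mxE; ring.
Qed.

Theorem theorem9p3 (R : realType) (f : R[i] -> R[i])
    (f_entire : entire f) (f_neq0 : exists z, f z != 0)
    (f_three_term : three_term f)
    (kappa : R[i]) (kappa_neq0 : kappa != 0) (kappa_generic : generic f kappa)
    (D : set 'cV[R[i]]_10) (DV : D `<=` VE8)
    (D_stable : forall w x, WE8 w -> D x -> D (w *m x))
    (D_transl : [set x + kappa *: q | x in D & q in QE8] = D)
    (tau : 'cV[R[i]]_10 -> R[i]) (tau_ORG : ORG_tau f kappa D tau) :
  [/\ forall L : 'cV[R[i]]_10, Mlat L -> QE8 (projV (L - e 9)),
      forall (L : 'cV[R[i]]_10) y, Mlat L -> Utilde kappa D y ->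
        D (tau_arg kappa L y) &
      lattice_tau f (Utilde kappa D) (tau_tilde kappa tau)].
Proof.
have DQ x q : D x -> QE8 q -> D (x + kappa *: q).
  by move=> Dx Qq; rewrite -D_transl; exists x => //; exists q.
have argD L y : QE8 (projV (L - e 9)) -> Utilde kappa D y ->
    D (tau_arg kappa L y).
  move=> QL /Utilde_elim[Ww _ Dy]; rewrite /tau_arg mulmxDr -scalemxAr.
  by apply: DQ => //; apply: WE8_QE8 => //; apply: WE8_invmx.
split=> [L /QE8_projV_Mlat[] //|L y /QE8_projV_Mlat[_ QL]|]; first exact: argD.
split.
- move=> g y Wg /Utilde_elim[Wy cy Dy].
  have [Wp [a Qa def_g]] := finite_partP Wg; rewrite /act.
  move: (finite_part g) Wp def_g => p Wp ->.
  have Va := QE8_VE8 Qa.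
  have Wpy : WE8 (p *m y.1) by exact: generatedM.
  apply: Utilde_intro; first exact: Wpy.
    rewrite [_.2]/= -mulmxA.
    by rewrite (form_c_transl _ (VE8_form_c Va)) WE8_form_c.
  rewrite [_.1]/= [_.2]/= -mulmxA (projV_transl _ Va) (WE8_form_c _ Wp) cy.
  rewrite (WE8_projV _ Wp) mulmxDr -scalemxAr.
  rewrite (mulmx_invmxK _ (WE8_unit Wp) (WE8_unit Wy)).
  by apply: DQ; [exact: Dy|]; apply: WE8_QE8 => //; apply: WE8_invmx.
- move=> g L y Wg ML /Utilde_elim[Wy cy Dy].
  have [Wp [a Qa def_g]] := finite_partP (generatedV Wg : WE81 (invmx g)).
  have MgL : Mlat (g *m L).
    have [k Wk <-] := ML; rewrite mulmxA.
    by exists (g *m k) => //; apply: generatedM.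
  have [cgL _] := QE8_projV_Mlat MgL.
  rewrite /tau_tilde !tau_argE /act [_.1]/= [_.2]/=.
  (* With [L] written as [invmx g *m (g *m L)], [invmx g] acts on both the
     point and [L]. *)
  rewrite -[L in LHS](mulKmx (WE81_unit Wg)).
  move: (g *m L) cgL {MgL} => L' cL'; apply: (congr1 tau).
  move: (finite_part _) Wp def_g => p Wp ->; rewrite -!mulmxA.
  exact: transl_cancel (QE8_VE8 Qa) Wp Wy cy cL'.
- move=> i j k l ijkl9 ijkl y Uy.
  have [Ww cy Dy] := Utilde_elim Uy.
  have [eps eps0 fN] := three_term_parity f_three_term.
  have Wi := WE8_invmx Ww.
  pose A m := invmx y.1 *m frame_vec R l m.
  have frame : C3_frame (A i) (A j) (A k).
    exact: C3_frame_WE8 Wi (C3_frame_vec R ijkl9 ijkl).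
  move: ijkl9 ijkl; case/and5P=> i9 j9 k9 l9 _; rewrite /= !inE !negb_or !andbT.
  case/and3P=> /and3P[ij ik il] /andP[jk jl] kl.
  pose X := invmx y.1 *m (projV y.2 + kappa *: projV (centre R l)).
  have argP m : tau_arg kappa (e m) y = X + kappa *: A m.
    rewrite tau_argE (projV_e_centre R l m) scalerDr addrA mulmxDr.
    by rewrite -scalemxAr.
  have argN m : tau_arg kappa (e 0 - e m - e l) y = X - kappa *: A m.
    rewrite tau_argE (projV_e0_centre R l m) scalerBr addrA mulmxBr.
    by rewrite -scalemxAr.
  have DP m : (1 <= m <= 9)%N -> D (X + kappa *: A m).
    by move=> m9; rewrite -argP; apply: argD => //; apply: QE8_projV_e2.
  have DN m : (1 <= m <= 9)%N -> D (X - kappa *: A m).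
    move=> m9; rewrite -argN; apply: argD => //.
    exact: (QE8_projV_e3 R m9 l9 (isT : 1 <= 9 <= 9)%N).
  have fB m n : (1 <= m <= 9)%N -> (1 <= n <= 9)%N -> m != l -> n != l ->
      f (form (A m - A n) X) = sigma f (e2 m n) y.
    move=> m9 n9 ml nl; rewrite /A /X -mulmxBr WE8_form // frame_vecB.
    rewrite form_projV_centre // ?form_c_e2 //.
    by rewrite /e2 form_addl formNl !form_e_centre // subrr.
  have fD m n : (1 <= m <= 9)%N -> (1 <= n <= 9)%N -> m != l -> n != l ->
      f (form (A m + A n) X) = eps * sigma f (e3 m n l) y.
    move=> m9 n9 ml nl; rewrite /A /X -mulmxDr WE8_form // frame_vecD formNl fN.
    by rewrite form_projV_centre // ?form_c_e3 // form_e3_centre.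
  have VX : VE8 X.
    apply: WE8_VE8 => //; apply: VE8_D; first exact: VE8_projV.
    by apply: VE8_Z; apply: VE8_projV.
  (* By [argP] and [argN], the six points of the frame are the arguments of
     [tau] at the six lattice vectors of the relation. *)
  have rel := tau_ORG (A i) (A j) (A k) X frame VX (DP i i9) (DN i i9)
    (DP j j9) (DN j j9) (DP k k9) (DN k k9).
  rewrite /tau_tilde !argP !argN; clearbody X A.
  move: rel; rewrite (fD j k j9 k9 jl kl) (fB j k j9 k9 jl kl).
  rewrite (fD k i k9 i9 kl il) (fB k i k9 i9 kl il).
  rewrite (fD i j i9 j9 il jl) (fB i j i9 j9 il jl) => rel.
  (* The parity constant is common to the three terms of the relation. *)
  have factor (s1 s2 s3 r1 r2 r3 t1 t2 t3 u1 u2 u3 : R[i]) :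
      eps * r1 * s1 * (t1 * u1) + eps * r2 * s2 * (t2 * u2)
        + eps * r3 * s3 * (t3 * u3) = 0 ->
      s1 * r1 * t1 * u1 + s2 * r2 * t2 * u2 + s3 * r3 * t3 * u3 = 0.
    by move=> h0; apply: (mulfI eps0); rewrite mulr0 -[RHS]h0; ring.
  exact: factor rel.
Qed.
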